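(* For every $p\in[0,1/2)$, the insertion-based noisy sorting capacity satisfies $$C_{\mathrm{ins}}(p)\le \frac{1}{\frac{1}{1-H(p)}+\frac{1}{D(p\|1-p)}}.$$
   Context: Noisy sorting problem. Fix $p\in[0,1/2)$. Let $\theta_1,\ldots,\theta_n$ be distinct reals with ordering $\pi$ ($\theta_{\pi(1)}<\cdots<\theta_{\pi(n)}$). A query is a pair $(U_k,V_k)=(\theta_i,\theta_j)$, $i\ne j$, answered by $Y_k=\mathbb{1}_{\{U_k<V_k\}}\oplus Z_k$ with $Z_k$ i.i.d. $\mathrm{Bern}(p)$. Insertion-based noisy sorting codes: start with the list $(\theta_n)$; for $i=1,\ldots,n-1$, given the current estimated ordered list $(\theta_{\sigma(1)},\ldots,\theta_{\sigma(i)})$ of the elements $\theta_{n-i+1},\ldots,\theta_n$, run a noisy searching procedure (adaptive, possibly randomized, possibly with a response-dependent number of queries) whose queries compare $\theta_{n-i}$ with elements of the list, producing an estimated position $\hat l\in[i+1]$, and insert $\theta_{n-i}$ into the list at position $\hat l$ (i.e., the list becomes $(\sigma(1),\ldots,\sigma(\hat l-1),n-i,\sigma(\hat l),\ldots,\sigma(i))$); after $n-1$ insertions the final list is the estimate $\hat\Pi$. Different choices of the searching procedure give different codes. Its rate is $R=\frac{n\log_2 n}{\mathbb{E}[M]}$, where $M$ is the total number of queries over all insertions. A rate $R_{\mathrm{ins}}$ is insertion-sort-achievable if there is a sequence (indexed by $n$) of insertion-based codes of rate $R_{\mathrm{ins}}$ with $\lim_{n\to\infty}\max_\pi\mathbb{P}\{\hat\Pi\ne\pi\}=0$;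 $C_{\mathrm{ins}}(p)$ is the supremum of such rates. $H(p)=-p\log_2 p-(1-p)\log_2(1-p)$ and $D(p\|1-p)=p\log_2\frac{p}{1-p}+(1-p)\log_2\frac{1-p}{p}$ (with the convention $1/\infty=0$ when $p=0$). *)

(* Defs.v *)
From HB Require Import structures.
From mathcomp Require Import all_boot all_order all_algebra.
From mathcomp Require Import all_classical all_reals all_analysis.
Set Implicit Arguments. Unset Strict Implicit. Unset Printing Implicit Defensive.
Import Order.TTheory GRing.Theory Num.Theory.
Local Open Scope ring_scope.

Section NoisySorting.
Variable R : realType.

Definition log2 (x : R) : R := ln x / ln 2.
Definition Hb (p : R) : R := - p * log2 p - (1 - p) * log2 (1 - p).
Definition Dpq (p : R) : R :=
  p * log2 (p / (1 - p)) + (1 - p) * log2 ((1 - p) / p).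
(* 1 / D(p||1-p), with the convention 1/oo = 0 when p = 0 *)
Definition invD (p : R) : R := if p == 0 then 0 else 1 / Dpq p.
Definition ins_bound (p : R) : R := 1 / (1 / (1 - Hb p) + invD p).

(* A query is (j, o): compare the new element with the j-th list element
   (0-indexed); o = true means (U,V) = (new, list elt), o = false the reverse. *)
Definition query (t : nat) := ('I_t * bool)%type.
(* An action is either "stop and insert at (0-indexed) position l" or a query. *)
Definition action (t : nat) := ('I_t.+1 + query t)%type.
Definition hist (t : nat) := seq (query t * bool).
Definition search_proc (t : nat) := hist t -> {ffun action t -> R}.
Definition valid_proc t (P : search_proc t) : Prop :=
  forall h, (forall a, 0 <= P h a) /\ \sum_a P h a = 1.

Definition code := forall t : nat, search_proc t.
Definition valid_code (c : code) : Prop := forall t, valid_proc (c t).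

Variable p : R.

(* probability that, from history h, the procedure makes exactly k more
   queries and then stops with output l; tr q = 1{U<V} for query q *)
Fixpoint stop_prob t (P : search_proc t) (tr : query t -> bool)
    (k : nat) (h : hist t) (l : 'I_t.+1) : R :=
  match k with
  | 0 => P h (inl l)
  | k'.+1 => \sum_(q : query t) P h (inr q) *
       ((1 - p) * stop_prob P tr k' (rcons h (q, tr q)) l
        + p * stop_prob P tr k' (rcons h (q, ~~ tr q)) l)
  end.

(* elements are indices 0..n-1 (index i stands for theta_{i+1}) *)
Definition truth (theta : nat -> R) (s : seq nat) (x : nat) t (q : query t)
  : bool :=
  let y := nth 0 s q.1 in if q.2 then theta x < theta y else theta y < theta x.

Definition insert_at (l : nat) (x : nat) (s : seq nat) : seq nat :=
  take l s ++ x :: drop l s.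

Variables (n : nat) (c : code) (theta : nat -> R).

(* probability that the remaining m insertions (starting at step t with list s)
   use at most T queries in total and the final list satisfies E.
   At step t the inserted element is theta_{n-t}, i.e. index n - t - 1. *)
Fixpoint run (E : pred (seq nat)) (m t : nat) (s : seq nat) (T : nat) : R :=
  match m with
  | 0 => if E s then 1 else 0
  | m'.+1 => \sum_(k < T.+1) \sum_(l : 'I_t.+1)
       @stop_prob t (@c t) (@truth theta s (n - t.+1) t) k [::] l
       * run E m' t.+1 (insert_at l (n - t.+1) s) (T - k)
  end.

Definition P_le (E : pred (seq nat)) (T : nat) : R :=
  run E n.-1 1 [:: n.-1] T.

(* the true ordering pi as the list [pi(1); ...; pi(n)] (0-indexed) *)
Definition true_order : seq nat := sort (fun a b => theta a <= theta b) (iota 0 n).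

(* P{ Pi_hat <> pi } (non-termination counted as error) *)
Definition P_err : R :=
  1 - sup [set P_le (fun s => s == true_order) T | T in [set: nat]].

(* E[M] = sum_{T >= 0} P{M > T} *)
Definition EM : \bar R := \sum_(0 <= T <oo) ((1 - P_le predT T)%:E)%E.

End NoisySorting.

Definition distinct_on (R : realType) (n : nat) (theta : nat -> R) : Prop :=
  forall a b, (a < n)%N -> (b < n)%N -> theta a = theta b -> a = b.

Definition maxEM (R : realType) (p : R) (n : nat) (c : code R) : \bar R :=
  ereal_sup [set EM p n c theta | theta in [set th | distinct_on n th]].

Definition rate (R : realType) (p : R) (n : nat) (c : code R) : \bar R :=
  match maxEM p n c with
  | r%:E => if r == 0 then +oo%E else ((n%:R * log2 n%:R) / r)%:E
  | _ => 0%E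
  end.

Definition ins_achievable (R : realType) (p : R) (Rins : R) : Prop :=
  exists c : nat -> code R,
    (forall n, valid_code (c n)) /\
    (exists N, forall n, (N <= n)%N -> (Rins%:E <= rate p n (c n))%E) /\
    (forall eps : R, 0 < eps -> exists N, forall n, (N <= n)%N ->
       forall theta : nat -> R, distinct_on n theta -> P_err p n (c n) theta <= eps).

Definition C_ins (R : realType) (p : R) : \bar R :=
  ereal_sup [set r%:E | r in ins_achievable p].

(* Main.v *)
Require Import Defs.
From HB Require Import structures.
From mathcomp Require Import all_boot all_order all_algebra.
From mathcomp Require Import all_classical all_reals all_analysis.
From mathcomp Require Import ring lra zify.
Import Order.TTheory GRing.Theory Num.Theory.
Local Open Scope ring_scope.
Set Implicit Arguments. Unset Strict Implicit. Unset Printing Implicit Defensive.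

(* A search with error penalty [lam] costs at least
   ln t / capacity + ln lam / D in expectation when the position is uniform, up
   to lower-order terms.  This is a Bellman argument on the unnormalised
   posterior weights: one query lowers the posterior entropy by at most the
   capacity, and lowers the log-residue, sum_i w_i ln (1 - w_i) for normalised
   w, by at most the divergence D.  The entropy is the potential while the
   posterior error exceeds a fixed e, the log-residue afterwards.

   For a uniformly random order every insertion is such a search.  A wrong
   insertion can never be repaired, so a penalty Lam ~ n ln n on the final error
   dominates, at every step, the penalty n on the current search plus the cost
   of the remaining searches.  Hence E[M] + Lam P_err is at least the sum of the
   search bounds with lam = n, and Lam P_err = o(n ln n). *)

(** * Entropy inequalities for one binary noisy answer *)

Section Entropy.
Variable R : realType.
Implicit Types x y a b p : R.

Definition xlnx x : R := x * ln x.

(** The bound [ln z <= z - 1] at [z = y / x], multiplied by x. The Gibbs-type and tangent-line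
    estimates below rest on it. *)
Lemma xln_sub_le x y : 0 <= x -> 0 < y -> x * ln y - x * ln x <= y - x.
Proof.
rewrite le_eqVlt => /predU1P[<- y0|x0 y0]; first by rewrite !mul0r !subr0 ltW.
have h : ln (y / x) <= y / x - 1.
  have := @le_ln1Dx R (y / x - 1); rewrite (_ : 1 + _ = y / x); last by ring.
  by apply; rewrite ltrBrDl subrr divr_gt0.
rewrite -mulrBr -ln_div ?posrE//.
apply: le_trans (ler_wpM2l (ltW x0) h) _.
by rewrite mulrBr mulr1 mulrCA divff ?gt_eqF// mulr1.
Qed.

Lemma xlnxM x y : 0 <= x -> 0 <= y -> xlnx (x * y) = x * xlnx y + y * xlnx x.
Proof.
rewrite /xlnx le_eqVlt => /predU1P[<- _|x0]; first by rewrite !mul0r mulr0 addr0.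
rewrite le_eqVlt => /predU1P[<-|y0]; first by rewrite !mulr0 !mul0r mulr0 addr0.
by rewrite lnM ?posrE//; ring.
Qed.

(** A binary answer carries at most ln 2 of entropy: both masses are compared with their mean. *)
Lemma xlnx_halving x y : 0 <= x -> 0 <= y ->
  xlnx (x + y) - (x + y) * ln 2 <= xlnx x + xlnx y.
Proof.
move=> x0 y0; have [s0|] := ltrP 0 (x + y); last first.
  move=> h; have -> : x = 0 by lra.
  have -> : y = 0 by lra.
  by rewrite /xlnx !(mul0r, addr0) subr0.
have h0 : 0 < (x + y) / 2 by lra.
have := xln_sub_le x0 h0; have := xln_sub_le y0 h0.
by rewrite ln_div ?posrE// /xlnx; lra.
Qed.

(* The entropy of the output of the channel is at least that of its noise. *)
Lemma channel_entropy_ge p a b : 0 < p < 1 -> 0 <= a -> 0 <= b ->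
  xlnx (a * (1 - p) + b * p) + xlnx (a * p + b * (1 - p)) <=
  xlnx (a + b) + (a + b) * (xlnx p + xlnx (1 - p)).
Proof.
move=> /andP[p0 p1] a0 b0; have [s0|] := ltrP 0 (a + b); last first.
  move=> h; have -> : a = 0 by lra.
  have -> : b = 0 by lra.
  by rewrite /xlnx !mul0r addr0 !mul0r !addr0.
have q0 : 0 < 1 - p by lra.
(* Jensen for the convex function x ln x in homogeneous form: the weights u, v have total a + b
   instead of 1, which produces the last term. *)
have key u v c d : 0 < c -> 0 < d -> 0 <= u -> 0 <= v -> u + v = a + b ->
    xlnx (u * c + v * d) <= u * xlnx c + v * xlnx d + (u * c + v * d) * ln (a + b).
  move=> c0 d0 u0 v0 uv; set w := u * c + v * d.
  have w0 : 0 < w.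
    rewrite /w; have [u1|u1] := ltrP 0 u; first by rewrite ltr_wpDr ?mulr_ge0 ?mulr_gt0// ltW.
    by rewrite ltr_wpDl ?mulr_ge0 ?(ltW c0)// mulr_gt0//; lra.
  have e1 := xln_sub_le (ltW (mulr_gt0 s0 c0)) w0.
  have e2 := xln_sub_le (ltW (mulr_gt0 s0 d0)) w0.
  have f1 : u * (c * ln w) - u * (c * (ln (a + b) + ln c)) <= u * (w / (a + b)) - u * c.
    move: e1; rewrite lnM ?posrE// => e1.
    rewrite -!mulrBr ler_wpM2l// -(ler_pM2l s0) mulrBr.
    rewrite (_ : (a + b) * (w / (a + b) - c) = w - (a + b) * c);
      first by apply: le_trans e1; rewrite -mulrBr; lra.
    by field; lra.
  have f2 : v * (d * ln w) - v * (d * (ln (a + b) + ln d)) <= v * (w / (a + b)) - v * d.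
    move: e2; rewrite lnM ?posrE// => e2.
    rewrite -!mulrBr ler_wpM2l// -(ler_pM2l s0) mulrBr.
    rewrite (_ : (a + b) * (w / (a + b) - d) = w - (a + b) * d);
      first by apply: le_trans e2; rewrite -mulrBr; lra.
    by field; lra.
  have e3 : u * (w / (a + b)) + v * (w / (a + b)) = w.
    by rewrite -mulrDl uv mulrCA divff ?gt_eqF// mulr1.
  have hw : w = u * c + v * d by [].
  have e4 z : w * z = u * (c * z) + v * (d * z) by rewrite hw; ring.
  by rewrite /xlnx !e4; move: f1 f2; lra.
have k1 := key _ _ _ _ q0 p0 a0 b0 erefl.
have k2 := key _ _ _ _ q0 p0 b0 a0 (addrC _ _).
move: k1 k2; rewrite [b * (1 - p) + _]addrC /xlnx; lra.
Qed.

(** The divergence [Dpq] in nats. *)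
Definition kl_flip p : R := (1 - p) * ln ((1 - p) / p) + p * ln (p / (1 - p)).

(* The divergence from Bern(p) of any Bernoulli law with parameter in
   [p, 1-p] is largest at 1-p. *)
Lemma cross_entropy_le p u v : 0 < p < 1 / 2 -> p * (u + v) <= u -> p * (u + v) <= v ->
  0 < u + v ->
  (1 - p) * (ln (u + v) - ln u) + p * (ln (u + v) - ln v) <=
  kl_flip p - (xlnx p + xlnx (1 - p)).
Proof.
move=> /andP[p0 p2] pu pv r0; have q0 : 0 < 1 - p by lra.
have u0 : 0 < u by apply: lt_le_trans pu; rewrite mulr_gt0.
have v0 : 0 < v by apply: lt_le_trans pv; rewrite mulr_gt0.
rewrite /kl_flip !ln_div ?posrE// /xlnx.
(* Tangents at u : v = p : 1 - p, the point where the bound is attained. *)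
have e1 := xln_sub_le (ltW u0) (mulr_gt0 p0 r0).
have e2 := xln_sub_le (ltW v0) (mulr_gt0 q0 r0).
rewrite !lnM ?posrE// in e1 e2.
set L := ln (u + v) in e1 e2 *; set lu := ln u in e1 *; set lv := ln v in e2 *.
have f1 : (1 - p) * (ln p + L - lu) <= (1 - p) * (p * (u + v) / u - 1).
  rewrite ler_pM2l// -(ler_pM2l u0) (_ : u * (_ - 1) = p * (u + v) - u); last by field; lra.
  by move: e1; rewrite -mulrBr.
have f2 : p * (ln (1 - p) + L - lv) <= p * ((1 - p) * (u + v) / v - 1).
  rewrite ler_pM2l// -(ler_pM2l v0) (_ : v * (_ - 1) = (1 - p) * (u + v) - v); last by field; lra.
  by move: e2; rewrite -mulrBr.
(* The factor (1 - p) v - p u equals v - p (u + v), so both factors are nonnegative by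
   hypothesis. *)
have g : (1 - p) * (p * (u + v) / u - 1) + p * ((1 - p) * (u + v) / v - 1) <= 0.
  rewrite (_ : _ + _ = - (u - p * (u + v)) * ((1 - p) * v - p * u) / (u * v)); last by field; lra.
  rewrite pmulr_lle0 ?invr_gt0 ?mulr_gt0// mulNr oppr_le0 mulr_ge0 ?subr_ge0//.
  by move: pv; nra.
by move: f1 f2 g; lra.
Qed.

End Entropy.

(** * The two potentials and their drift under a query *)

Section Potentials.
Variables (R : realType) (I : finType) (p : R).
Implicit Types (w : I -> R) (x : I -> bool).

Definition likelihood (y b : bool) : R := if y == b then 1 - p else p.

(** The posterior stays unnormalised: [x i] is the noiseless answer under hypothesis i, and the new
    weights are joint with the answer y, so the masses for the two answers add up to the old
    mass. *)
Definition update w x y : I -> R := fun i => w i * likelihood y (x i).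

(** With W the total mass, this is W times the Shannon entropy in nats of w / W. *)
Definition entropy w : R := xlnx (\sum_i w i) - \sum_i xlnx (w i).

(** With W the total mass, this is the homogeneous form of [sum_i w_i ln (1 - w_i / W)]. *)
Definition log_residue w : R :=
  \sum_i w i * ln (\sum_j w j - w i) - xlnx (\sum_i w i).

(** The capacity [1 - Hb p] of the binary symmetric channel, in nats. *)
Definition capacity : R := ln 2 + xlnx p + xlnx (1 - p).

Lemma sum_update w x : \sum_i update w x true i + \sum_i update w x false i = \sum_i w i.
Proof.
rewrite -big_split; apply: eq_bigr => i _; rewrite /update /likelihood.
by case: (x i) => /=; ring.
Qed.

Lemma update_ge0 w x y i : 0 <= p <= 1 -> 0 <= w i -> 0 <= update w x y i.
Proof.
by move=> /andP[p0 p1] w0; rewrite mulr_ge0// /likelihood; case: ifP => _; lra.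
Qed.

(** Mutual information is at most capacity: the answer has entropy at most ln 2, and given the
    hypothesis its entropy is exactly that of the noise. *)
Lemma entropy_drift w x : 0 <= p <= 1 -> (forall i, 0 <= w i) ->
  entropy w <= (\sum_i w i) * capacity +
    entropy (update w x true) + entropy (update w x false).
Proof.
move=> /andP[p0 p1] w0.
have u0 y i : 0 <= update w x y i by apply: update_ge0 => //; apply/andP.
have W0 y : 0 <= \sum_i update w x y i by apply: sumr_ge0.
have := xlnx_halving (W0 true) (W0 false); rewrite sum_update => h.
have e : \sum_i xlnx (update w x true i) + \sum_i xlnx (update w x false i) =
    \sum_i xlnx (w i) + (\sum_i w i) * (xlnx p + xlnx (1 - p)).
  rewrite mulr_suml -!big_split; apply: eq_bigr => i _.
  have q0 : 0 <= 1 - p by lra.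
  by rewrite /update /likelihood; case: (x i) => /=; rewrite !xlnxM//; ring.
rewrite /entropy /capacity; lra.
Qed.

(** Fano's inequality: the entropy is at most the cross entropy relative to a reference law that
    puts one half on i and spreads the rest. *)
Lemma entropy_le w i : (forall j, 0 <= w j) -> 0 < \sum_j w j ->
  entropy w <= (\sum_j w j) * ln 2 + (\sum_j w j - w i) * ln #|I|%:R.
Proof.
move=> w0; set W := \sum_j w j => W0.
have n0 : 0 < #|I|%:R :> R by rewrite ltr0n; apply/card_gt0P; exists i.
(* Dividing by the full cardinality leaves total mass below 1, which is enough for Gibbs's
   inequality. *)
pose q j : R := if j == i then 1 / 2 else 1 / 2 / #|I|%:R.
have q0 j : 0 < q j by rewrite /q; case: ifP => _; rewrite ?divr_gt0.
have sq : \sum_j q j <= 1.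
  rewrite (bigD1 i)//= {1}/q eqxx.
  rewrite (eq_bigr (fun=> 1 / 2 / #|I|%:R)); last by move=> j /negPf ji; rewrite /q ji.
  have : \sum_(j | j != i) (1 / 2 / #|I|%:R : R) <= \sum_(j : I) (1 / 2 / #|I|%:R).
    by rewrite [leRHS](bigD1 i)//= lerDr !divr_ge0// ltW.
  rewrite [X in _ <= X]sumr_const -[(_ / _) *+ _]mulr_natr mulfVK ?gt_eqF//; lra.
have h : \sum_j (w j * ln (W * q j) - xlnx (w j)) <= 0.
  apply: (@le_trans _ _ (\sum_j (W * q j - w j))).
    by apply: ler_sum => j _; apply: xln_sub_le => //; apply: mulr_gt0.
  by rewrite sumrB -mulr_sumr -/W subr_le0 ler_piMr// ltW.
move: h; rewrite sumrB.
rewrite (eq_bigr (fun j => w j * ln W + w j * ln (q j))); last first.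
  by move=> j _; rewrite lnM ?posrE// mulrDr.
rewrite big_split/= -mulr_suml -/W.
have -> : \sum_j w j * ln (q j) = - (W * ln 2) - (W - w i) * ln #|I|%:R.
  rewrite (bigD1 i)//= {1}/q eqxx div1r lnV ?posrE//.
  rewrite (eq_bigr (fun j => w j * (- ln 2 - ln #|I|%:R))); last first.
    by move=> j /negPf ji; rewrite /q ji ln_div ?posrE// div1r lnV ?posrE.
  rewrite -mulr_suml.
  have -> : \sum_(j | j != i) w j = W - w i.
    by rewrite /W [in RHS](bigD1 i)//= addrAC subrr add0r.
  by ring.
rewrite /entropy -/W [xlnx W]/xlnx. move: (\sum_j xlnx _) => S; lra.
Qed.

Lemma entropy_le_card w (i : I) : (forall j, 0 <= w j) -> 0 < \sum_j w j ->
  entropy w <= (\sum_j w j) * ln #|I|%:R.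
Proof.
move=> w0; set W := \sum_j w j => W0.
have n0 : 0 < #|I|%:R :> R by rewrite ltr0n; apply/card_gt0P; exists i.
have : \sum_j (w j * ln (W / #|I|%:R) - xlnx (w j)) <= 0.
  apply: (@le_trans _ _ (\sum_j (W / #|I|%:R - w j))).
    by apply: ler_sum => j _; apply: xln_sub_le => //; apply: divr_gt0.
  by rewrite sumrB -/W sumr_const -[(_ / _) *+ _]mulr_natr mulfVK ?gt_eqF// subrr.
rewrite sumrB -mulr_suml -/W ln_div ?posrE// /entropy -/W [xlnx W]/xlnx; lra.
Qed.

(** Both likelihoods are at least p because p <= 1/2. This supplies the hypotheses of
    [cross_entropy_le]. *)
Lemma update_lower w x y i : 0 <= p <= 1 / 2 -> (forall j, 0 <= w j) ->
  p * (\sum_j w j - w i) <= \sum_j update w x y j - update w x y i.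
Proof.
move=> /andP[p0 p2] w0.
rewrite (bigD1 i)//= [leRHS](_ : _ = \sum_(j | j != i) update w x y j); last first.
  by rewrite (bigD1 i)//=; ring.
rewrite addrAC subrr add0r mulr_sumr; apply: ler_sum => j _.
by rewrite mulrC ler_wpM2l// /likelihood; case: ifP => _; lra.
Qed.

(** For each hypothesis the expected change of the log of the residual mass is bounded by
    [cross_entropy_le]. Its excess over [kl_flip p], the noise entropy, cancels against
    [channel_entropy_ge] applied to the total masses. *)
Lemma log_residue_drift w x : 0 < p < 1 / 2 -> (forall i, 0 <= w i) ->
  (forall i, w i < \sum_j w j) ->
  log_residue w <= (\sum_i w i) * kl_flip p +
    log_residue (update w x true) + log_residue (update w x false).
Proof.
move=> /andP[p0 p2] w0 res0; set W := \sum_i w i.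
have p01 : 0 <= p <= 1 / 2 by apply/andP; split; lra.
have /= ent : xlnx (\sum_i update w x true i) + xlnx (\sum_i update w x false i) <=
    xlnx W + W * (xlnx p + xlnx (1 - p)).
  pose a := \sum_(i | x i) w i; pose b := \sum_(i | ~~ x i) w i.
  have -> : \sum_i update w x true i = a * (1 - p) + b * p.
    rewrite (bigID x)/= !mulr_suml; congr (_ + _); apply: eq_bigr => i xi;
    by rewrite /update/likelihood ?xi//; move/negPf: xi => ->.
  have -> : \sum_i update w x false i = a * p + b * (1 - p).
    rewrite (bigID x)/= !mulr_suml; congr (_ + _); apply: eq_bigr => i xi;
    by rewrite /update/likelihood ?xi//; move/negPf: xi => ->.
  have -> : W = a + b by rewrite /W (bigID x).
  by apply: channel_entropy_ge; rewrite ?sumr_ge0//; apply/andP; split; lra.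
have : \sum_i (w i * ln (W - w i)
    - update w x true i * ln (\sum_j update w x true j - update w x true i)
    - update w x false i * ln (\sum_j update w x false j - update w x false i)) <=
    \sum_i w i * (kl_flip p - (xlnx p + xlnx (1 - p))).
  apply: ler_sum => i _.
  set u := \sum_j update w x true j - update w x true i.
  set v := \sum_j update w x false j - update w x false i.
  have uv : u + v = W - w i.
    rewrite /u /v /W -(sum_update w x); set A := \sum_j _; set B := \sum_j _.
    by rewrite /update/likelihood; case: (x i) => /=; ring.
  have r0 : 0 < W - w i by rewrite subr_gt0.
  have pu : p * (u + v) <= u by rewrite uv; apply: update_lower.
  have pv : p * (u + v) <= v by rewrite uv; apply: update_lower.
  rewrite -uv in r0 *.
  have pp : 0 < p < 1 / 2 by apply/andP.
  have := cross_entropy_le pp pu pv r0.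
  have vu := addrC u v.
  (* Either answer may be the likelier one, depending on [x i], so the bound is needed in both
     orders. *)
  have := @cross_entropy_le _ p v u pp; rewrite -vu => /(_ pv pu r0).
  rewrite /update/likelihood; case: (x i) => /= h1 h2; rewrite -!mulrA -!mulrBr ler_wpM2l//; lra.
rewrite !sumrB -mulr_suml -/W /log_residue -/W; lra.
Qed.

Lemma log_residue_ge w c : (forall i, 0 <= w i) -> 0 < c -> 0 < \sum_i w i ->
  (forall i, c * (\sum_j w j) <= \sum_j w j - w i) ->
  (\sum_i w i) * ln c <= log_residue w.
Proof.
move=> w0 c0; set W := \sum_i w i => W0 h.
have -> : W * ln c = W * ln (c * W) - xlnx W by rewrite lnM ?posrE// /xlnx; ring.
rewrite /log_residue -/W lerB// {1}/W mulr_suml ler_sum// => i _.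
have cW : 0 < c * W by rewrite mulr_gt0.
by rewrite ler_wpM2l// ler_ln ?posrE// (lt_le_trans cW).
Qed.

(* The bound (1-e) ln e <= ln e + 1 with e the residual mass, then
   ln z <= z - 1 at z = a e. *)
Lemma log_residue_le w i a : (forall i, 0 <= w i) ->
  (forall i, w i < \sum_j w j) -> 0 < a ->
  log_residue w + (\sum_j w j) * ln a <= a * (\sum_j w j - w i).
Proof.
move=> w0 res0 a0; set W := \sum_j w j.
have W0 : 0 < W by apply: le_lt_trans (res0 i).
have r0 : 0 < W - w i by rewrite subr_gt0.
have h : log_residue w <= w i * ln (W - w i) - w i * ln W.
  rewrite /log_residue -/W /xlnx {2}/W mulr_suml -sumrB (bigD1 i)//= gerDl.
  rewrite sumr_le0// => j _.
  rewrite -mulrBr mulr_ge0_le0// subr_le0 ler_ln ?posrE ?subr_gt0 ?res0//.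
  by rewrite gerBl.
have e1 := xln_sub_le (ltW r0) W0.
have aW : 0 < a * (W - w i) by rewrite mulr_gt0.
have e2 := xln_sub_le (ltW W0) aW.
rewrite lnM ?posrE// in e2; lra.
Qed.

End Potentials.

(** * Bellman lower bounds for a single noisy search *)

Section Search.
Variables (R : realType) (p : R) (t : nat) (P : search_proc R t).
Hypothesis P_valid : valid_proc P.
Implicit Types (tr : query t -> bool) (h : hist t) (l : 'I_t.+1) (lam : R) (w : 'I_t.+1 -> R).

Definition stopped tr T h : R :=
  \sum_(k < T.+1) \sum_l stop_prob p P tr k h l.

Definition hit tr T h l : R := \sum_(k < T.+1) stop_prob p P tr k h l.

(** With M the number of further queries, the sum is E[min(M, N)]. Not having stopped within N
    queries counts as an error. Truncation at N allows induction on N. *)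
Definition search_cost lam tr N h l : R :=
  \sum_(T < N) (1 - stopped tr T h) + lam * (1 - hit tr N h l).

Lemma proc_sum h : \sum_l P h (inl l) + \sum_q P h (inr q) = 1.
Proof. by have [_ <-] := P_valid h; rewrite big_sumType. Qed.

Lemma proc_ge0 h a : 0 <= P h a.
Proof. by have [] := P_valid h. Qed.

Definition noisy tr (F : hist t -> R) h (q : query t) : R :=
  (1 - p) * F (rcons h (q, tr q)) + p * F (rcons h (q, ~~ tr q)).

Lemma hitS tr T h l :
  hit tr T.+1 h l = P h (inl l) + \sum_q P h (inr q) * noisy tr (fun h' => hit tr T h' l) h q.
Proof.
rewrite /hit big_ord_recl /=; congr (_ + _).
rewrite exchange_big; apply: eq_bigr => q _ /=.
by rewrite -mulr_sumr big_split /= -!mulr_sumr.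
Qed.

Lemma stoppedE tr T h : stopped tr T h = \sum_l hit tr T h l.
Proof. by rewrite /stopped exchange_big. Qed.

Lemma stoppedS tr T h :
  stopped tr T.+1 h = \sum_l P h (inl l) + \sum_q P h (inr q) * noisy tr (stopped tr T) h q.
Proof.
rewrite stoppedE (eq_bigr _ (fun l _ => hitS tr T h l)) big_split /=; congr (_ + _).
rewrite exchange_big; apply: eq_bigr => q _ /=.
by rewrite -mulr_sumr big_split/= -!mulr_sumr /noisy !stoppedE.
Qed.

Lemma search_cost0 lam tr h l : search_cost lam tr 0 h l = lam * (1 - P h (inl l)).
Proof. by rewrite /search_cost big_ord0 add0r /hit big_ord1. Qed.

(** Conditioning on the first action. The term T = 0 of the truncated count is the probability of
    asking at all; it gives the unit price of a query. *)
Lemma search_costS lam tr N h l : search_cost lam tr N.+1 h l =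
  \sum_q P h (inr q) * (1 + noisy tr (fun h' => search_cost lam tr N h' l) h q)
  + lam * (\sum_l' P h (inl l') - P h (inl l)).
Proof.
have ps := proc_sum h.
have e T : 1 - stopped tr T.+1 h =
    \sum_q P h (inr q) * noisy tr (fun h' => 1 - stopped tr T h') h q.
  rewrite stoppedS -{1}ps opprD addrACA subrr add0r -sumrB; apply: eq_bigr => q _.
  by rewrite /noisy; ring.
have e' : 1 - hit tr N.+1 h l = \sum_l' P h (inl l') - P h (inl l) +
    \sum_q P h (inr q) * noisy tr (fun h' => 1 - hit tr N h' l) h q.
  rewrite hitS -{1}ps opprD addrACA; congr (_ + _); rewrite -sumrB; apply: eq_bigr => q _.
  by rewrite /noisy; ring.
rewrite /search_cost big_ord_recl e' mulrDr.
have -> : 1 - stopped tr (@ord0 N) h = \sum_q P h (inr q).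
  by rewrite /stopped big_ord1 /= -{1}ps addrAC subrr add0r.
rewrite (eq_bigr _ (fun T _ => e _)) exchange_big /=.
rewrite addrCA addrC; congr (_ + _).
rewrite mulr_sumr -!big_split; apply: eq_bigr => q _ /=.
rewrite -mulr_sumr /noisy big_split /= -!mulr_sumr.
ring.
Qed.

Variable x : 'I_t.+1 -> query t -> bool.

(** Here [x l] gives the noiseless answers when l is the correct position, and w is an unnormalised
    prior on l. *)
Definition weighted_cost lam N h w : R :=
  \sum_l w l * search_cost lam (x l) N h l.

Definition answer_cost lam N h w q (y : bool) : R :=
  weighted_cost lam N (rcons h (q, y)) (update p w (x ^~ q) y).

Lemma weighted_cost0 lam h w : weighted_cost lam 0 h w =
  \sum_l P h (inl l) * (lam * (\sum_l' w l' - w l)) +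
  \sum_q P h (inr q) * (lam * \sum_l' w l').
Proof.
rewrite -mulr_suml [in RHS](eq_bigr (fun l =>
  P h (inl l) * (lam * \sum_l' w l') - lam * (w l * P h (inl l)))); last first.
  by move=> l _; ring.
rewrite sumrB -mulr_suml addrAC -mulrDl proc_sum mul1r -mulr_sumr -mulrBr -sumrB mulr_sumr.
by apply: eq_bigr => l _; rewrite search_cost0; ring.
Qed.

(** Averaging over l absorbs the channel probabilities into the weights, so each continuation is the
    weighted cost of the posterior. *)
Lemma weighted_costS lam N h w : weighted_cost lam N.+1 h w =
  \sum_l P h (inl l) * (lam * (\sum_l' w l' - w l)) +
  \sum_q P h (inr q) * (\sum_l w l + answer_cost lam N h w q true + answer_cost lam N h w q false).
Proof.
rewrite /weighted_cost (eq_bigr (fun l =>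
  \sum_q w l * (P h (inr q) *
    (1 + noisy (x l) (fun h' => search_cost lam (x l) N h' l) h q))
  + w l * (lam * (\sum_l' P h (inl l') - P h (inl l))))); last first.
  by move=> l _; rewrite search_costS mulrDr mulr_sumr.
rewrite big_split /= addrC; congr (_ + _).
  transitivity (lam * ((\sum_l' P h (inl l')) * (\sum_l w l) - \sum_l w l * P h (inl l))).
    rewrite mulr_sumr -sumrB mulr_sumr; apply: eq_bigr => l _.
    by move: (\sum_l' P h (inl l')) => S; ring.
  rewrite mulr_suml -sumrB mulr_sumr; apply: eq_bigr => l _.
  by move: (\sum_l' w l') => S; ring.
rewrite exchange_big; apply: eq_bigr => q _ /=.
rewrite /answer_cost /weighted_cost -!big_split mulr_sumr; apply: eq_bigr => l _ /=.
by rewrite /update /likelihood /noisy; case: (x l q) => /=; ring.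
Qed.

(** The first action is a convex mixture of stops and queries, so it suffices to bound each pure
    action. The form of the last hypothesis suits strong induction on N. *)
Lemma weighted_cost_ge lam N h w v : 0 <= lam -> (forall l, 0 <= w l) ->
  (forall l, v <= lam * (\sum_l' w l' - w l)) ->
  (forall M q, (M < N)%N ->
    v <= \sum_l w l + answer_cost lam M h w q true + answer_cost lam M h w q false) ->
  v <= weighted_cost lam N h w.
Proof.
move=> lam0 w0 stop ask; rewrite -[v]mul1r -(proc_sum h) mulrDl !mulr_suml.
case: N ask => [|N] ask.
  rewrite weighted_cost0 lerD// ler_sum// => *; rewrite ler_wpM2l ?proc_ge0//.
  (* With no budget left a query forfeits the full penalty, which is no less than the loss of
     stopping. *)
  by apply: le_trans (stop ord0) _; rewrite ler_wpM2l// gerBl.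
rewrite weighted_costS lerD// ler_sum// => *; rewrite ler_wpM2l ?proc_ge0//; exact: ask.
Qed.

(** The inductive step shared by all potentials E / C + W L: a drift of at most C per unit mass is
    paid for by the unit price of the query. *)
Lemma drift_step (C L E E1 E2 W1 W2 A1 A2 : R) : 0 < C ->
  E <= (W1 + W2) * C + E1 + E2 ->
  E1 / C + W1 * L <= A1 -> E2 / C + W2 * L <= A2 ->
  E / C + (W1 + W2) * L <= W1 + W2 + A1 + A2.
Proof.
move=> C0; have Ci : 0 < C^-1 by rewrite invr_gt0.
by rewrite -(ler_pM2r Ci) !mulrDl !mulfK ?gt_eqF//; lra.
Qed.

(** Induction with the entropy as potential. At a stop, Fano's inequality leaves the residual mass
    times ln (t + 1), which the penalty covers. *)
Lemma weighted_cost_entropy lam N h w : 0 <= p <= 1 -> 0 < capacity p ->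
  0 <= lam -> ln t.+1%:R / capacity p <= lam -> (forall l, 0 <= w l) ->
  entropy w / capacity p + (\sum_l w l) * (- (ln 2 / capacity p)) <= weighted_cost lam N h w.
Proof.
move=> p01 C0 lam0 lamC; elim/ltn_ind: N h w => N IH h w w0.
have W0 : 0 <= \sum_l w l by apply: sumr_ge0.
apply: weighted_cost_ge => // [l|M q MN].
  have r0 : 0 <= \sum_l' w l' - w l by rewrite subr_ge0 (bigD1 l)//= lerDl sumr_ge0.
  rewrite mulrN mulrA -mulrBl ler_pdivrMr//.
  have /(ler_wpM2l r0) : ln t.+1%:R <= lam * capacity p by rewrite -ler_pdivrMr.
  (* At p = 0 an answer may be impossible and leave all weights zero. *)
  move: W0; rewrite le_eqVlt => /predU1P[W0|W0].
    have w00 j : w j = 0.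
      have /eqP := esym W0; rewrite psumr_eq0// => /allP/(_ j).
      by rewrite mem_index_enum => /(_ isT)/eqP.
    rewrite /entropy -W0 w00 /xlnx big1 => [|j _]; last by rewrite w00 mul0r.
    by rewrite !(mul0r, subr0, mulr0).
  have := entropy_le l w0 W0; rewrite card_ord.
  by move: (entropy w) (\sum_l w l) => E W; lra.
have u0 y l : 0 <= update p w (x^~ q) y l by apply: update_ge0.
have := entropy_drift (x^~ q) p01 w0.
rewrite -(sum_update p w (x^~ q)) => /drift_step; apply => //; exact: IH.
Qed.

Lemma lt_total w : (0 < t)%N -> (forall l, 0 < w l) -> forall l, w l < \sum_l' w l'.
Proof.
move=> t0 w0 l; rewrite (bigD1 l)//= ltrDl.
have [j jl] : exists j : 'I_t.+1, j != l.
  have [->|h] := eqVneq l ord0; last by exists ord0; rewrite eq_sym.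
  by exists ord_max; rewrite -val_eqE /= -lt0n.
by rewrite (bigD1 j)//= ltr_wpDr// sumr_ge0// => i _; apply: ltW.
Qed.

(** Induction with the log-residue as potential. At a stop, [log_residue_le] with a = lam D, where D
    is [kl_flip p], bounds it by the penalty; this is the origin of ln (lam D) / D. *)
Lemma weighted_cost_residue lam N h w : 0 < p < 1 / 2 -> (0 < t)%N ->
  0 < kl_flip p -> 0 < lam -> (forall l, 0 < w l) ->
  log_residue w / kl_flip p + (\sum_l w l) * (ln (lam * kl_flip p) / kl_flip p) <=
  weighted_cost lam N h w.
Proof.
move=> p01 t0 D0 lam0; elim/ltn_ind: N h w => N IH h w w0.
have w0' l : 0 <= w l by apply: ltW.
have wW := lt_total t0 w0.
apply: weighted_cost_ge => // [|l|M q MN]; first exact: ltW.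
  rewrite mulrA -mulrDl ler_pdivrMr// mulrAC; apply: log_residue_le => //; exact: mulr_gt0.
have u0 y l : 0 < update p w (x^~ q) y l.
  by rewrite mulr_gt0// /likelihood; move/andP: p01 => [? ?]; case: ifP => _; lra.
have := log_residue_drift (x^~ q) p01 w0' wW.
rewrite -(sum_update p w (x^~ q)) => /drift_step; apply => //; exact: IH.
Qed.

(* As long as the posterior error is at least [e], the entropy potential is
   in force; when an answer makes it drop below [e] it is still at least
   [p * e], and the residue potential takes over. *)
Lemma weighted_cost_two_phase lam e N h w (K := (ln (p * e) + ln (lam * kl_flip p)) / kl_flip p -
      (ln 2 + e * ln t.+1%:R) / capacity p) :
  0 < p < 1 / 2 -> (0 < t)%N -> 0 < capacity p ->
  0 < kl_flip p -> 0 < lam -> 0 < e -> ln t.+1%:R / capacity p + K <= lam * e ->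
  (forall l, 0 < w l) -> (forall l, e * (\sum_l w l) <= \sum_l' w l' - w l) ->
  entropy w / capacity p + (\sum_l w l) * K <= weighted_cost lam N h w.
Proof.
move=> p01 t0 C0 D0 lam0 e0 lamK; elim/ltn_ind: N h w => N IH h w w0 we.
have /andP[p0 p1] := p01.
have Ci : 0 < (capacity p)^-1 by rewrite invr_gt0.
have Di : 0 < (kl_flip p)^-1 by rewrite invr_gt0.
have pp : 0 <= p <= 1 by apply/andP; split; lra.
have pp' : 0 <= p <= 1 / 2 by apply/andP; split; lra.
have w0' l : 0 <= w l by apply: ltW.
have W0 : 0 < \sum_l w l by apply: le_lt_trans (lt_total t0 w0 ord0).
apply: weighted_cost_ge => // [|l|M q MN]; first exact: ltW.
  (* A stop in the first phase has error at least e, so it pays lam e per unit mass, which exceeds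
     the potential by hypothesis on K. *)
  have h1 := ler_wpM2l (ltW lam0) (we l).
  have h2 := ler_wpM2l (ltW W0) lamK.
  have := entropy_le_card ord0 w0' W0; rewrite card_ord.
  rewrite -(ler_pM2r Ci) => h3.
  by move: h1 h2 h3; rewrite mulrDr !mulrA; lra.
have u0 y l : 0 < update p w (x^~ q) y l.
  by rewrite mulr_gt0// /likelihood; case: ifP => _; lra.
have u0' y l : 0 <= update p w (x^~ q) y l by apply: ltW.
have key y : entropy (update p w (x^~ q) y) / capacity p + (\sum_l update p w (x^~ q) y l) * K
    <= answer_cost lam M h w q y.
  set u := update p w (x^~ q) y.
  have U0 : 0 < \sum_l u l by apply: le_lt_trans (lt_total t0 (u0 y) ord0); apply: u0'.
  have [ue|] := boolP [forall l, e * (\sum_l u l) <= \sum_l' u l' - u l].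
    by apply: IH => // l; [exact: u0|exact: (forallP ue l)].
  rewrite negb_forall => /existsP[l]; rewrite -ltNge => /ltW ul.
  apply: le_trans (weighted_cost_residue _ _ p01 t0 D0 lam0 (u0 y)).
  have h1 := entropy_le l (u0' y) U0; rewrite card_ord -/u in h1.
  (* The entropy still left at the change of phase, by Fano; K subtracts exactly this amount. *)
  have h1' : entropy u <= (\sum_l u l) * (ln 2 + e * ln t.+1%:R).
    apply: le_trans h1 _; rewrite mulrDr lerD2l mulrA [_ * e]mulrC ler_wpM2r//.
    by rewrite ln_ge0// ler1n.
  have h2 : (\sum_l u l) * ln (p * e) <= log_residue u.
    apply: log_residue_ge => //; first exact: u0'; first exact: mulr_gt0.
    (* One answer shrinks the residual mass by a factor p at worst, and before it the error was at
       least e. *)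
    move=> j; apply: le_trans (update_lower _ _ _ pp' w0').
    rewrite -mulrA ler_pM2l//; apply: le_trans (we j); rewrite ler_pM2l//.
    rewrite -(sum_update p w (x^~ q)) /u.
    case: (y); rewrite ?lerDl ?lerDr; apply: sumr_ge0 => i _; exact: u0'.
  rewrite -(ler_pM2r Ci) in h1'.
  rewrite -(ler_pM2r Di) in h2.
  by move: h1' h2; rewrite /K mulrBr !mulrDl !mulrDr !mulrDl !mulrA; lra.
have := entropy_drift (x^~ q) pp w0'.
by rewrite -(sum_update p w (x^~ q)) => /drift_step; apply.
Qed.

End Search.

(** * Explicit bound for a uniform position and penalty n *)

Section UniformSearchBound.
Variable R : realType.

Lemma ln_affine_le (A B : R) : 0 < A ->
  exists N, forall n, (N <= n)%N -> (0 < n)%N /\ A * ln n%:R + B <= n%:R.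
Proof.
(* The tangent of ln at 2A gives A ln n <= n / 2 + A ln (2A); the other half of n absorbs the
   constants. *)
move=> A0; exists (maxn 1 (Num.truncn (2 * (A * ln (2 * A) + B))).+1) => n.
rewrite geq_max => /andP[n0 nN]; split=> //.
have nR : 0 < n%:R :> R by rewrite ltr0n.
have A2 : 0 < 2 * A by lra.
have h1 : 2 * (A * ln (2 * A) + B) <= n%:R.
  apply: ltW; apply: lt_le_trans (truncnS_gt _) _.
  by rewrite ler_nat.
have := xln_sub_le (ltW A2) nR; lra.
Qed.

Lemma capacity_gt0 (p : R) : 0 <= p -> p < 1 / 2 -> 0 < capacity p.
Proof.
move=> p0 p2; rewrite /capacity /xlnx.
move: p0; rewrite le_eqVlt => /predU1P[<-|p0].
  by rewrite mul0r subr0 ln1 mulr0 !addr0 ln_gt0// ltr1n.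
have q0 : 0 < 1 - p by lra.
have h0 : 0 < 1 / 2 :> R by lra.
have e2 := xln_sub_le (ltW q0) h0.
(* Strictness enters here, through 1 + y < exp y at y = 1 / (2p) - 1, which is nonzero. *)
have e1 : ln (1 / 2) - ln p < 1 / 2 / p - 1.
  rewrite -ln_div ?posrE//; set z := 1 / 2 / p.
  have z1 : z - 1 != 0.
    by rewrite subr_eq0; apply/eqP => /(congr1 ( *%R^~ p)); rewrite /z mulfVK ?gt_eqF//; lra.
  have := expR_gt1Dx z1; rewrite addrCA subrr addr0 => zl.
  by rewrite -[ltRHS]expRK ltr_ln// ?posrE ?expR_gt0//; rewrite /z; apply: divr_gt0.
have e3 : p * (1 / 2 / p - 1) = 1 / 2 - p by field; lra.
have := e1; rewrite -(ltr_pM2l p0) e3 mulrBr.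
have -> : ln (1 / 2) = - ln 2 :> R by rewrite div1r lnV// posrE.
by rewrite div1r lnV ?posrE// in e2; lra.
Qed.

Lemma kl_flip_gt0 (p : R) : 0 < p -> p < 1 / 2 -> 0 < kl_flip p.
Proof.
move=> p0 p2; have q0 : 0 < 1 - p by lra.
rewrite /kl_flip !ln_div ?posrE//.
have h : ln p < ln (1 - p) by rewrite ltr_ln ?posrE//; lra.
have : 0 < (1 - 2 * p) * (ln (1 - p) - ln p) by rewrite mulr_gt0//; lra.
lra.
Qed.

(** The counterpart of [invD] in nats. *)
Definition inv_kl_flip (p : R) : R := if p == 0 then 0 else (kl_flip p)^-1.

Lemma inv_kl_flip_ge0 (p : R) : 0 <= p -> p < 1 / 2 -> 0 <= inv_kl_flip p.
Proof.
rewrite /inv_kl_flip; case: eqVneq => // pn0 p0 p2; rewrite invr_ge0 ltW// kl_flip_gt0//.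
by rewrite lt_neqAle eq_sym pn0.
Qed.

(** All weights equal to 1 encode the uniform prior. K and the threshold on n depend only on p and
    e, so the bounds can be summed over all insertions. *)
Lemma search_cost_lower_bound (p e : R) : 0 <= p -> p < 1 / 2 -> 0 < e -> e <= 1 / 2 ->
  exists2 K : R, 0 <= K & exists N0, forall n, (N0 <= n)%N ->
  forall t (P : search_proc R t), (0 < t)%N -> (t < n)%N -> valid_proc P ->
  forall (x : 'I_t.+1 -> query t -> bool) N,
  t.+1%:R * ((1 - e) * ln t.+1%:R / capacity p + inv_kl_flip p * ln n%:R - K) <=
  \sum_l search_cost p P n%:R (x l) N [::] l.
Proof.
move=> p0 p2 e0 e2; have C0 := capacity_gt0 p0 p2.
have Ci : 0 < (capacity p)^-1 by rewrite invr_gt0.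
have w1 t (P : search_proc R t) (x : 'I_t.+1 -> query t -> bool) lam N :
    weighted_cost p P x lam N [::] (fun=> 1) = \sum_l search_cost p P lam (x l) N [::] l.
  by apply: eq_bigr => l _; rewrite mul1r.
have s1 t : \sum_(l < t.+1) 1 = t.+1%:R :> R by rewrite sumr_const card_ord.
have ent t : entropy (fun _ : 'I_t.+1 => 1 : R) = t.+1%:R * ln t.+1%:R :> R.
  by rewrite /entropy /= s1 big1 ?subr0// => l _; rewrite /xlnx ln1 mulr0.
(* Without noise the divergence is infinite and its term vanishes, so the entropy potential alone
   suffices. *)
have [pz|pnz] := eqVneq p 0.
  exists (ln 2 / capacity p); first by rewrite divr_ge0 ?ln_ge0 ?ler1n// ltW.
  have [N0 hN0] := ln_affine_le 0 Ci; exists N0 => n /hN0[n0 nln] t P t0 tn Pv x N.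
  rewrite -w1; apply: le_trans (weighted_cost_entropy Pv x N [::] _ C0 _ _ _) => //.
  - rewrite ent /= s1 (_ : inv_kl_flip p = 0); last by rewrite /inv_kl_flip pz eqxx.
    have : 0 <= t.+1%:R * (e * ln t.+1%:R / capacity p).
      by rewrite mulr_ge0// mulr_ge0 ?(ltW Ci)// mulr_ge0 ?(ltW e0)// ln_ge0// ler1n.
    lra.
  - by apply/andP; split; lra.
  - apply: le_trans nln; rewrite addr0 mulrC ler_pM2l// ler_ln ?posrE ?ltr0n//.
    by rewrite ler_nat.
have {}p0 : 0 < p by rewrite lt_neqAle eq_sym pnz.
have D0 := kl_flip_gt0 p0 p2.
pose B := (ln (p * e) + ln (kl_flip p)) / kl_flip p.
have l2 : 0 <= ln 2 / capacity p by rewrite divr_ge0 ?ln_ge0 ?ler1n// ltW.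
exists (`|B| + ln 2 / capacity p); first by rewrite addr_ge0.
(* Chosen so that for large n the penalty n e exceeds the initial potential, as the two-phase bound
   requires. *)
have A0 : 0 < ((capacity p)^-1 + (kl_flip p)^-1) / e.
  by rewrite divr_gt0// addr_gt0// invr_gt0.
have [N0 hN0] := ln_affine_le (`|B| / e) A0; exists N0 => n /hN0[n0 nln] t P t0 tn Pv x N.
have nR : 0 < n%:R :> R by rewrite ltr0n.
have lt0 : 0 <= ln t.+1%:R :> R by rewrite ln_ge0// ler1n.
have ltn : ln t.+1%:R <= ln n%:R :> R by rewrite ler_ln ?posrE ?ltr0n// ler_nat.
have Ble : B <= `|B| by apply: ler_norm.
have Bge : - `|B| <= B by apply: lerNnormlW.
have eK : (ln (p * e) + ln (n%:R * kl_flip p)) / kl_flip p -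
      (ln 2 + e * ln t.+1%:R) / capacity p =
    (kl_flip p)^-1 * ln n%:R + B - ln 2 / capacity p - e * ln t.+1%:R / capacity p.
  by rewrite [ln (n%:R * _)]lnM ?posrE// /B; ring.
have e3 : 0 <= e * ln t.+1%:R / capacity p by rewrite mulr_ge0 ?(ltW Ci)// mulr_ge0// ltW.
rewrite -w1; apply: le_trans (weighted_cost_two_phase Pv x N [::] _ t0 C0 D0 nR e0 _ _ _) => //.
- rewrite ent /= s1 eK /inv_kl_flip (negPf pnz) -[t.+1%:R * _ / _]mulrA -mulrDr ler_pM2l ?ltr0n//.
  by lra.
- by apply/andP; split; lra.
- rewrite eK.
  have : ln t.+1%:R / capacity p <= ln n%:R / capacity p by rewrite ler_pM2r.
  have := ler_wpM2r (ltW e0) nln.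
  rewrite mulrDl mulfVK ?gt_eqF// [_ / e * _]mulrC mulrA mulfVK ?gt_eqF//.
  by lra.
(* A uniform guess errs with probability t / (t + 1) >= 1/2 >= e, so the search starts in the first
   phase. *)
- move=> l; rewrite /= s1.
  have : 1 <= t%:R :> R by rewrite ler1n.
  rewrite -[t.+1%:R]natr1.
  have : e * (t%:R + 1) <= 1 / 2 * (t%:R + 1) :> R by rewrite ler_wpM2r// addr_ge0.
  lra.
Qed.

End UniformSearchBound.

(** * Stopping probabilities of a search *)

Section SearchProbabilities.
Variables (R : realType) (p : R) (t : nat) (P : search_proc R t).
Hypothesis P_valid : valid_proc P.
Hypothesis p01 : 0 <= p <= 1.

Lemma stop_prob_ge0 tr k h l : 0 <= stop_prob p P tr k h l.
Proof.
have /andP[p0 p1] := p01.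
elim: k h => [|k IH] h /=; first exact: proc_ge0.
apply: sumr_ge0 => q _; rewrite mulr_ge0 ?proc_ge0//.
by rewrite addr_ge0// mulr_ge0// subr_ge0.
Qed.

Lemma stopped_le1 tr T h : stopped p P tr T h <= 1.
Proof.
have /andP[p0 p1] := p01.
elim: T h => [|T IH] h; rewrite -(proc_sum P_valid h).
  by rewrite /stopped big_ord1 /= lerDl sumr_ge0// => q _; exact: proc_ge0.
rewrite stoppedS// lerD2l ler_sum// => q _; rewrite ler_piMr ?proc_ge0//.
have := ler_wpM2l p0 (IH (rcons h (q, ~~ tr q))).
have q0 : 0 <= 1 - p by lra.
have := ler_wpM2l q0 (IH (rcons h (q, tr q))).
rewrite /noisy; lra.
Qed.

End SearchProbabilities.

(** * Cost of a whole run of insertions *)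

Section Runs.
Variables (R : realType) (p : R) (n : nat) (c : Defs.code R).
Hypothesis c_valid : valid_code c.
Hypothesis p01 : 0 <= p <= 1.
Implicit Types (theta : nat -> R) (E : pred (seq nat)) (s : seq nat).

Lemma run_ge0 theta E m t s T : 0 <= run p n c theta E m t s T.
Proof.
elim: m t s T => [|m IH] t s T /=; first by case: ifP.
by rewrite sumr_ge0// => k _; rewrite sumr_ge0// => l _; rewrite mulr_ge0 ?stop_prob_ge0.
Qed.

Lemma run_le1 theta E m t s T : run p n c theta E m t s T <= 1.
Proof.
elim: m t s T => [|m IH] t s T /=; first by case: ifP.
apply: le_trans (stopped_le1 (@c_valid t) p01 (@truth R theta s (n - t.+1) t) T [::]).
by apply: ler_sum => k _; apply: ler_sum => l _; rewrite ler_piMr ?stop_prob_ge0.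
Qed.

Lemma run_nondecreasing theta E m t s :
  {homo run p n c theta E m t s : T T' / (T <= T')%N >-> T <= T'}.
Proof.
apply: homo_leq => [T|T1 T2 T3|T]; [exact: lexx|exact: le_trans|].
elim: m t s T => [|m IH] t s T //=.
rewrite [leRHS]big_ord_recr ler_wpDr//.
  by rewrite sumr_ge0// => l _; rewrite mulr_ge0 ?stop_prob_ge0 ?run_ge0.
apply: ler_sum => k _; apply: ler_sum => l _; rewrite ler_wpM2l ?stop_prob_ge0//.
have kT : (k <= T)%N by rewrite -ltnS.
by rewrite /= subSn ?IH.
Qed.

Lemma run_predC theta E m t s T :
  run p n c theta predT m t s T = run p n c theta E m t s T + run p n c theta (predC E) m t s T.
Proof.
elim: m t s T => [|m IH] t s T /=; first by case: ifP; rewrite ?addr0 ?add0r.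
rewrite -big_split; apply: eq_bigr => k _; rewrite -big_split; apply: eq_bigr => l _ /=.
by rewrite IH mulrDr.
Qed.

(** The analogue of [search_cost]: failing to finish within N queries also pays the penalty. *)
Definition run_cost lam theta E m t s N : R :=
  \sum_(T < N) (1 - run p n c theta predT m t s T) + lam * (1 - run p n c theta E m t s N).

Lemma sum_convolution (F : nat -> nat -> R) N :
  \sum_(T < N) \sum_(k < T.+1) F k (T - k)%N = \sum_(k < N.+1) \sum_(j < N - k) F k j.
Proof.
elim: N => [|N IH]; first by rewrite big_ord0 big_ord1 big_ord0.
rewrite big_ord_recr/= IH [RHS]big_ord_recr/= subnn big_ord0 addr0 -big_split.
apply: eq_bigr => k _ /=; have kN : (k <= N)%N by rewrite -ltnS.
by rewrite subSn// big_ord_recr.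
Qed.

(** Conditioning on the length k and the outcome l of the first search, which leaves a budget of N -
    k. *)
Lemma run_costS lam theta E m t s N (x := (n - t.+1)%N) (tr := @truth R theta s x t) :
  run_cost lam theta E m.+1 t s N =
  \sum_(T < N) (1 - stopped p (@c t) tr T [::]) + lam * (1 - stopped p (@c t) tr N [::]) +
  \sum_(k < N.+1) \sum_(l < t.+1) stop_prob p (@c t) tr k [::] l *
      run_cost lam theta E m t.+1 (insert_at l x s) (N - k).
Proof.
pose F k j := \sum_(l < t.+1) stop_prob p (@c t) tr k [::] l *
   (1 - run p n c theta predT m t.+1 (insert_at l x s) j).
have e T : 1 - run p n c theta predT m.+1 t s T =
    1 - stopped p (@c t) tr T [::] + \sum_(k < T.+1) F k (T - k)%N.
  rewrite /= /stopped -addrA; congr (1 + _); rewrite addrC -sumrB -sumrN.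
  apply: eq_bigr => k _; rewrite -sumrB -sumrN; apply: eq_bigr => l _.
  by rewrite -/x -/tr; ring.
have e' : 1 - run p n c theta E m.+1 t s N = 1 - stopped p (@c t) tr N [::] +
    \sum_(k < N.+1) \sum_(l < t.+1) stop_prob p (@c t) tr k [::] l *
     (1 - run p n c theta E m t.+1 (insert_at l x s) (N - k)).
  rewrite /= /stopped -addrA; congr (1 + _); rewrite addrC -sumrB -sumrN.
  apply: eq_bigr => k _; rewrite -sumrB -sumrN; apply: eq_bigr => l _.
  by rewrite -/x -/tr; ring.
rewrite /run_cost e' (eq_bigr _ (fun T _ => e _)) big_split /= sum_convolution mulrDr addrACA.
congr (_ + _); rewrite mulr_sumr -big_split; apply: eq_bigr => k _ /=.
rewrite /F exchange_big /= mulr_sumr -big_split; apply: eq_bigr => l _ /=.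
by rewrite -mulr_sumr; ring.
Qed.

(** If every wrong position costs at least lam later on, lam may be charged at once; the first
    insertion becomes a search with penalty lam and correct position l0. *)
Lemma run_cost_ge lam theta E m t s N (l0 : 'I_t.+1)
    (x := (n - t.+1)%N) (tr := @truth R theta s x t) :
  (forall l N', l != l0 -> lam <= run_cost lam theta E m t.+1 (insert_at l x s) N') ->
  search_cost p (@c t) lam tr N [::] l0 +
  \sum_(k < N.+1) stop_prob p (@c t) tr k [::] l0 *
      run_cost lam theta E m t.+1 (insert_at l0 x s) (N - k) <= run_cost lam theta E m.+1 t s N.
Proof.
move=> doomed; rewrite run_costS -/x -/tr /search_cost.
have -> : stopped p (@c t) tr N [::] = hit p (@c t) tr N [::] l0 +
    \sum_(k < N.+1) \sum_(l < t.+1 | l != l0) stop_prob p (@c t) tr k [::] l.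
  by rewrite /stopped -big_split; apply: eq_bigr => k _ /=; rewrite (bigD1 l0).
rewrite [X in _ + _ + X](eq_bigr _ (fun k _ => bigD1 l0 isT)) [X in _ <= _ + X]big_split /=.
have : lam * \sum_(k < N.+1) \sum_(l < t.+1 | l != l0) stop_prob p (@c t) tr k [::] l <=
   \sum_(k < N.+1) \sum_(l < t.+1 | l != l0) stop_prob p (@c t) tr k [::] l *
      run_cost lam theta E m t.+1 (insert_at l x s) (N - k).
  rewrite mulr_sumr; apply: ler_sum => k _; rewrite mulr_sumr; apply: ler_sum => l ll0.
  by rewrite mulrC ler_wpM2l ?stop_prob_ge0// doomed.
set A := \sum_(T < N) _; set S := \sum_(k < N.+1) _; set C := \sum_(k < N.+1) _.
set F := \sum_(k < N.+1) _; lra.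
Qed.

End Runs.

(** * List insertion and subsequences *)

Section Insertion.
Implicit Types (s u : seq nat) (x : nat).

Lemma perm_insert_at l x s : perm_eq (insert_at l x s) (x :: s).
Proof. by rewrite /insert_at -(cat1s x (drop l s)) perm_catCA /= cat_take_drop. Qed.

Lemma subseq_insert_at l x s : subseq s (insert_at l x s).
Proof.
by rewrite /insert_at -[X in subseq X _](cat_take_drop l s) cat_subseq// subseq_cons.
Qed.

Lemma index_insert_at l x s : (l <= size s)%N -> x \notin s -> index x (insert_at l x s) = l.
Proof.
move=> ls xs; have xt : x \notin take l s by apply: contra xs; apply: mem_take.
by rewrite /insert_at index_cat (negPf xt) /= eqxx addn0 size_takel.
Qed.

Lemma nth_insert_at l x s j : (l <= size s)%N ->
  nth 0%N (insert_at l x s) j =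
  if (j < l)%N then nth 0%N s j else if j == l then x else nth 0%N s j.-1.
Proof.
move=> ls; rewrite /insert_at nth_cat size_takel//.
case: ltnP => jl; first by rewrite nth_take.
case: eqVneq => [->|nl]; first by rewrite subnn.
have {nl}jl : (l < j)%N by rewrite ltn_neqAle eq_sym nl.
by case: j jl => // j; rewrite ltnS => jl; rewrite subSn//= nth_drop subnKC.
Qed.

(** A duplicate-free s is strictly sorted by position in s, and subsequences of sorted lists are
    sorted. *)
Lemma index_nth_lt u s i j : uniq s -> subseq u s -> (i < j < size u)%N ->
  (index (nth 0%N u i) s < index (nth 0%N u j) s)%N.
Proof.
move=> us su /andP[ij ju].
pose r := relpre (index^~ s) ltn.
have r_tr : transitive r by move=> y x z; apply: ltn_trans.
have rs : sorted r s.
  rewrite /r -sorted_map (_ : map _ s = iota 0 (size s)) ?iota_ltn_sorted//.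
  apply: (@eq_from_nth _ 0%N); rewrite ?size_map ?size_iota// => k ks.
  by rewrite (nth_map 0%N)// nth_iota// index_uniq.
have := subseq_sorted r_tr su rs.
move=> /(sorted_ltn_nth r_tr 0%N)/(_ i j); rewrite !inE => h.
by apply: h => //; apply: ltn_trans ju.
Qed.

(** A subsequence of a duplicate-free list is determined by its set of elements, which is the same
    for both insertions. Hence at most one position agrees with the final order. *)
Lemma subseq_insert_at_inj l l' x s u : uniq u -> x \notin s ->
  (l <= size s)%N -> (l' <= size s)%N ->
  subseq (insert_at l x s) u -> subseq (insert_at l' x s) u -> l = l'.
Proof.
move=> uu xs ls ls' /(subseq_uniqP uu) e /(subseq_uniqP uu) e'.
rewrite -(index_insert_at ls xs) -(index_insert_at ls' xs) e e'.
congr (index _ _); apply: eq_filter => y.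
by rewrite (perm_mem (perm_insert_at l x s)) (perm_mem (perm_insert_at l' x s)).
Qed.

End Insertion.

(** * Realising a prescribed order and its noiseless answers *)

Section TrueOrder.
Variable R : realType.

(** An instance theta whose increasing order is u; averages over orders thus run over admissible
    instances. *)
Definition rank_in (u : seq nat) : nat -> R := fun y => (index y u)%:R.

Lemma rank_in_distinct n u : perm_eq u (iota 0 n) -> distinct_on n (rank_in u).
Proof.
move=> pu a b an bn /eqP; rewrite eqr_nat => /eqP; apply: (index_inj 0%N).
  by rewrite (perm_mem pu) mem_iota.
by rewrite (perm_mem pu) mem_iota.
Qed.

Lemma true_order_rank_in n u : perm_eq u (iota 0 n) -> true_order n (rank_in u) = u.
Proof.
move=> pu; rewrite /true_order.
have uu : uniq u by rewrite (perm_uniq pu) iota_uniq.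
pose r := relpre (index^~ u) leq.
have -> : (fun a b => rank_in u a <= rank_in u b) = r.
  by apply/funext => a; apply/funext => b; rewrite /rank_in ler_nat.
have r_tr : transitive r by move=> y x z; apply: leq_trans.
have ru : sorted r u.
  rewrite /r -sorted_map (_ : map _ u = iota 0 (size u)) ?iota_sorted//.
  apply: (@eq_from_nth _ 0%N); rewrite ?size_map ?size_iota// => k ks.
  by rewrite (nth_map 0%N)// nth_iota// index_uniq.
have r_tot : total r by move=> a b; apply: leq_total.
have sr := sort_sorted r_tot (iota 0 n).
apply: (sorted_eq_in _ _ sr ru); last by rewrite perm_sort perm_sym.
  by move=> a b d _ _ _; apply: r_tr.
move=> a b; rewrite !mem_sort -!(perm_mem pu) => au bu; rewrite /r/= -eqn_leq => /eqP.
exact: (index_inj 0%N).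
Qed.

Definition position_truth t (l : 'I_t.+1) (q : query t) : bool :=
  if q.2 then (l <= q.1)%N else (q.1 < l)%N.

(** In u the first l elements of s precede x and the others follow. The answers depend on l alone,
    which reduces an insertion to the abstract search. *)
Lemma truth_rank_in t (l : 'I_t.+1) x s u : uniq u -> size s = t ->
  subseq (insert_at l x s) u -> @truth R (rank_in u) s x t = position_truth l.
Proof.
move=> uu ss su; apply/funext => -[j b]; rewrite /truth /position_truth /=.
have ls : (l <= size s)%N by rewrite ss -ltnS.
have sz : size (insert_at l x s) = t.+1 by rewrite (perm_size (perm_insert_at l x s)) /= ss.
have jt := ltn_ord j.
rewrite /rank_in !ltr_nat; case: (leqP l j) => lj.
  have : (index x u < index (nth 0%N s j) u)%N.
    (* Inserting at l <= j shifts the j-th list element to position j + 1. *)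
    have := @index_nth_lt (insert_at l x s) u l j.+1 uu su.
    rewrite sz !nth_insert_at// ltnn eqxx [(j.+1 < l)%N]ltnNge (leq_trans lj)//=.
    by rewrite gtn_eqF ?ltnS//=; apply; rewrite lj.
  by move=> h; case: b; rewrite ?h// ltnNge ltnW.
have : (index (nth 0%N s j) u < index x u)%N.
  have := @index_nth_lt (insert_at l x s) u j l uu su.
  by rewrite sz !nth_insert_at// lj ltnn eqxx; apply; rewrite ltn_ord.
by move=> h; case: b; rewrite ?h// ltnNge ltnW.
Qed.

End TrueOrder.

(** * Averaging over uniformly random orders *)

Section Average.
Variables (R : realType) (n : nat).
Implicit Types (F : seq nat -> R) (s : seq nat).

(* The mean of [F] over the final orders reached from [s] when every missing
   element is inserted at a uniformly random position. *)
Fixpoint insertion_mean (m t : nat) s F : R :=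
  match m with
  | 0 => F s
  | m'.+1 => t.+1%:R^-1 *
      \sum_(l < t.+1) insertion_mean m' t.+1 (insert_at l (n - t.+1) s) F
  end.

(** Linearity in the shape of the bound of [run_cost_ge]: the cost of the current search plus
    continuations weighted by stopping probabilities. *)
Lemma insertion_mean_affine m t s (b : R) N (a : 'I_N -> R) (F : 'I_N -> seq nat -> R) :
  insertion_mean m t s (fun u => b + \sum_k a k * F k u) =
  b + \sum_k a k * insertion_mean m t s (F k).
Proof.
elim: m t s => [//|m IH] t s /=.
under eq_bigr do rewrite IH.
rewrite big_split /= sumr_const card_ord mulrDr -[b *+ _]mulr_natl mulKf ?pnatr_eq0//.
congr (_ + _); rewrite exchange_big mulr_sumr; apply: eq_bigr => k _ /=.
by rewrite -mulr_sumr mulrCA.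
Qed.

Lemma perm_next t s (l : nat) : (t < n)%N -> perm_eq s (iota (n - t) t) ->
  perm_eq (insert_at l (n - t.+1) s) (iota (n - t.+1) t.+1).
Proof.
move=> tn ps; apply: perm_trans (perm_insert_at _ _ _) _.
by rewrite /= -subSn// subSS perm_cons.
Qed.

Lemma insertion_mean_le m t s F G : (t + m)%N = n -> perm_eq s (iota (n - t) t) ->
  (forall u, perm_eq u (iota 0 n) -> subseq s u -> F u <= G u) ->
  insertion_mean m t s F <= insertion_mean m t s G.
Proof.
elim: m t s => [|m IH] t s tm ps FG /=.
  by apply: FG => //; move: ps; rewrite -tm addn0 subnn.
rewrite ler_pM2l ?invr_gt0 ?ltr0n//; apply: ler_sum => l _; apply: IH.
- by rewrite addSnnS.
- by apply: perm_next => //; rewrite -tm addnS ltnS leq_addr.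
- move=> u pu su; apply: FG => //; apply: subseq_trans su; exact: subseq_insert_at.
Qed.

End Average.

(** * Summing the search bounds over all insertions *)

Section LowerBound.
Variables (R : realType) (p : R) (n : nat) (c : Defs.code R).
Hypothesis c_valid : valid_code c.
Hypothesis p01 : 0 <= p <= 1.
Implicit Types (theta : nat -> R) (s u : seq nat).

(** Insertions only extend the list, so a wrong insertion is never repaired. *)
Lemma run_not_subseq theta u m t s T : ~~ subseq s u ->
  run p n c theta (fun s' => s' == u) m t s T = 0.
Proof.
elim: m t s T => [|m IH] t s T su /=.
  by case: eqP su => // ->; rewrite subseq_refl.
rewrite big1// => k _; rewrite big1// => l _; rewrite IH ?mulr0//.
by apply: contra su; apply: subseq_trans; apply: subseq_insert_at.
Qed.

Lemma sum_not_run_ge0 theta E m t s N : 0 <= \sum_(T < N) (1 - run p n c theta E m t s T).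
Proof. by rewrite sumr_ge0// => T _; rewrite subr_ge0 run_le1. Qed.

Lemma hit_le1 t (P : search_proc R t) tr N l : valid_proc P -> hit p P tr N [::] l <= 1.
Proof.
move=> Pv; apply: le_trans (stopped_le1 Pv p01 tr N [::]).
rewrite stoppedE (bigD1 l)//= lerDl sumr_ge0// => l' _.
by rewrite sumr_ge0// => k _; apply: stop_prob_ge0.
Qed.

(** [phi t] bounds the mean cost of a search among t elements with penalty lam; the final penalty
    Lam dominates lam plus the bounds of the remaining searches. *)
Variables (lam Lam : R) (phi : nat -> R).
Hypothesis search_ge : forall t (x : 'I_t.+1 -> query t -> bool) N, (0 < t < n)%N ->
  t.+1%:R * phi t <= \sum_l search_cost p (@c t) lam (x l) N [::] l.
Hypothesis Lam_ge : forall t, lam + \sum_(t <= i < n) phi i <= Lam.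

(** Induction on the remaining insertions: the current search has a uniform correct position and
    yields [phi t], and the continuation after a correct insertion yields the rest. *)
Lemma run_cost_mean_ge m t s N : (0 < t)%N -> (t + m)%N = n -> perm_eq s (iota (n - t) t) ->
  \sum_(t <= i < n) phi i <=
  insertion_mean n m t s (fun u => run_cost p n c Lam (rank_in R u) (fun s' => s' == u) m t s N).
Proof.
elim: m t s N => [|m IH] t s N t0 tm ps /=.
  rewrite big_geq -?tm ?addn0// /run_cost /= eqxx subrr mulr0 addr0 sumr_ge0//.
have tn : (t < n)%N by rewrite -tm addnS ltnS leq_addr.
set x := (n - t.+1)%N.
have ss : size s = t by rewrite (perm_size ps) size_iota.
have xs : x \notin s.
  by rewrite (perm_mem ps) mem_iota /x; apply/negP => /andP[]; lia.
set V := \sum_(t.+1 <= i < n) phi i.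
have step l : search_cost p (@c t) lam (position_truth l) N [::] l + V <=
    insertion_mean n m t.+1 (insert_at l x s) (fun u =>
      run_cost p n c Lam (rank_in R u) (fun s' => s' == u) m.+1 t s N).
  pose a (k : 'I_N.+1) := stop_prob p (@c t) (position_truth l) k [::] l.
  pose F (k : 'I_N.+1) u :=
    run_cost p n c Lam (rank_in R u) (fun s' => s' == u) m t.+1 (insert_at l x s) (N - k).
  have tm' : (t.+1 + m)%N = n by rewrite addSnnS.
  have ps' := perm_next l tn ps.
  apply: (@le_trans _ _ (insertion_mean n m t.+1 (insert_at l x s) (fun u =>
     search_cost p (@c t) Lam (position_truth l) N [::] l + \sum_k a k * F k u))).
    rewrite insertion_mean_affine.
    apply: (@le_trans _ _ (search_cost p (@c t) Lam (position_truth l) N [::] l + \sum_k a k * V)).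
      (* The rest V is gained only on a hit; the loss (1 - hit) V is covered by raising the penalty
         from lam to Lam >= lam + V. *)
      rewrite -mulr_suml -/(hit p (@c t) (position_truth l) N [::] l) /search_cost -!addrA lerD2l.
      have h1 := hit_le1 (position_truth l) N l (@c_valid t).
      have := Lam_ge t.+1; rewrite -/V => hL.
      have h0 : 0 <= 1 - hit p (@c t) (position_truth l) N [::] l by rewrite subr_ge0.
      have := ler_wpM2r h0 hL; move: (hit _ _ _ _ _ _) => H; lra.
    rewrite lerD2l; apply: ler_sum => k _; rewrite ler_wpM2l ?stop_prob_ge0//.
    exact: IH.
  apply: insertion_mean_le => // u pu su.
  have uu : uniq u by rewrite (perm_uniq pu) iota_uniq.
  have tr := truth_rank_in R uu ss su.
  have := @run_cost_ge _ p n _ c_valid p01 Lam (rank_in R u) (fun s' => s' == u) m t s N l.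
  rewrite /= -/x tr; apply => l' N' l'l.
  have nsu : ~~ subseq (insert_at l' x s) u.
    apply: contra l'l => su'; apply/eqP/val_inj.
    by apply: (subseq_insert_at_inj uu xs) su' su; rewrite ss -ltnS.
  by rewrite /run_cost run_not_subseq// subr0 mulr1 lerDr sum_not_run_ge0.
rewrite -(ler_pM2l (_ : 0 < t.+1%:R :> R)) ?ltr0n// mulrA divff ?pnatr_eq0// mul1r.
apply: (@le_trans _ _ (\sum_(l < t.+1) (search_cost p (@c t) lam (position_truth l) N [::] l + V))).
  rewrite big_split /= sumr_const card_ord big_ltn// -/V mulrDr -[V *+ _]mulr_natl lerD2r.
  by apply: search_ge; rewrite t0.
by apply: ler_sum => l _; apply: step.
Qed.

Lemma EM_partial theta N r : (Defs.EM p n c theta <= r%:E)%E ->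
  \sum_(T < N) (1 - P_le p n c theta predT T) <= r.
Proof.
move=> h; rewrite -lee_fin; apply: le_trans h.
rewrite -sumEFin -(big_mkord xpredT (fun T => (1 - P_le p n c theta predT T)%:E)).
by apply: nneseries_lim_ge => T _ _; rewrite lee_fin subr_ge0 run_le1.
Qed.

(** Ending wrongly within N and correctly within T queries are disjoint; the common budget
    [maxn T N] bounds their total by 1. *)
Lemma wrong_le_P_err theta N :
  P_le p n c theta (predC (fun s => s == true_order n theta)) N <= P_err p n c theta.
Proof.
set E := fun s => s == true_order n theta.
rewrite /P_err lerBrDl -lerBrDr; apply: ge_sup; first by exists (P_le p n c theta E 0), 0%N.
move=> _ [T _ <-]; rewrite lerBrDr -/E.
apply: le_trans (run_le1 n c_valid p01 theta predT n.-1 1 [:: n.-1] (maxn T N)).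
rewrite (run_predC _ _ _ _ E) lerD// run_nondecreasing//; [exact: leq_maxl|exact: leq_maxr].
Qed.

(** The truncation is removed by letting N grow: by Markov a run exceeds N queries with probability
    at most r / (N + 1). *)
Lemma expected_queries_ge r eps : (0 < n)%N -> 0 <= Lam ->
  (forall theta, distinct_on n theta -> (Defs.EM p n c theta <= r%:E)%E) ->
  (forall theta, distinct_on n theta -> P_err p n c theta <= eps) ->
  \sum_(1 <= i < n) phi i <= r + Lam * eps.
Proof.
move=> n0 L0 EMr Peps; set V := \sum_(_ <= i < n) _.
have bound N : V <= r + Lam * (r / N.+1%:R + eps).
  have ps : perm_eq [:: n.-1] (iota (n - 1) 1) by rewrite subn1.
  have n1 : (1 + n.-1)%N = n by rewrite add1n prednK.
  apply: le_trans (@run_cost_mean_ge n.-1 1 [:: n.-1] N isT n1 ps) _.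
  (* The mean of a constant, written with an empty sum so that the affine lemma evaluates it. *)
  apply: (@le_trans _ _ (insertion_mean n n.-1 1 [:: n.-1] (fun u =>
      r + Lam * (r / N.+1%:R + eps) + \sum_(k < 0) 0 * 0))); last first.
    by rewrite (insertion_mean_affine _ _ _ _ _ (fun=> 0) (fun _ _ => 0)) big_ord0 addr0.
  apply: insertion_mean_le => // u pu _; rewrite big_ord0 addr0.
  have du := @rank_in_distinct R n u pu.
  have EN := EM_partial N (EMr _ du).
  have EN1 := EM_partial N.+1 (EMr _ du).
  have Pe := le_trans (wrong_le_P_err (rank_in R u) N) (Peps _ du).
  rewrite (@true_order_rank_in R n u pu) in Pe.
  rewrite /run_cost lerD// ler_wpM2l//.
  have -> : run p n c (rank_in R u) (fun s' => s' == u) n.-1 1 [:: n.-1] N =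
     P_le p n c (rank_in R u) predT N - P_le p n c (rank_in R u) (predC (fun s' => s' == u)) N.
    by rewrite /P_le (run_predC _ _ _ _ (fun s' => s' == u)) addrK.
  (* Markov: the tail is nonincreasing, so N + 1 times its value at N is at most its partial sum. *)
  have : 1 - P_le p n c (rank_in R u) predT N <= r / N.+1%:R.
    rewrite ler_pdivlMr ?ltr0n//; apply: le_trans EN1.
    rewrite mulr_natr -[in leLHS](card_ord N.+1) -sumr_const; apply: ler_sum => T _.
    by rewrite lerB// run_nondecreasing// -ltnS.
  by move=> h; rewrite opprB addrCA addrC; apply: lerD.
rewrite leNgt; apply/negP => gap.
have gap' : 0 < V - (r + Lam * eps) by rewrite subr_gt0.
set d := V - _ in gap'.
(* For this N the term Lam r / (N + 1) falls below the gap d. *)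
have := bound (Num.truncn (Lam * r / d)).
rewrite leNgt => /negP; apply.
set N := Num.truncn _.
have : Lam * r / d < N.+1%:R by apply: truncnS_gt.
rewrite ltr_pdivrMr// => h.
have {}h : Lam * r / N.+1%:R < d by rewrite ltr_pdivrMr ?ltr0n// [d * _]mulrC.
have -> : V = r + Lam * eps + d by rewrite /d addrC subrK.
by rewrite mulrDr mulrA -[ltRHS]addrA ltrD2l [ltRHS]addrC ltrD2r.
Qed.

End LowerBound.

(** * Asymptotics of the rate *)

Section Asymptotics.
Variable R : realType.

(** The crude Stirling bound for ln n!. *)
Lemma sum_ln_ge n : (0 < n)%N ->
  n%:R * ln n%:R - n%:R <= \sum_(1 <= i < n) ln i.+1%:R :> R.
Proof.
case: n => // n _; elim: n => [|n IH]; first by rewrite big_geq// ln1 mulr0 sub0r oppr_le0.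
rewrite big_nat_recr//=.
have n0 : 0 <= n.+1%:R :> R by [].
have n1 : 0 < n.+2%:R :> R by rewrite ltr0n.
have := xln_sub_le n0 n1; move: IH; rewrite -[n.+2%:R]natr1.
lra.
Qed.

(** Passage from bits to nats, each information quantity being divided by ln 2. *)
Lemma ins_boundE (p : R) : 0 <= p -> p < 1 / 2 ->
  ins_bound p = (ln 2 * ((capacity p)^-1 + inv_kl_flip p))^-1.
Proof.
move=> p0 p2; have C0 := capacity_gt0 p0 p2.
have l2 : 0 < ln 2 :> R by rewrite ln_gt0// ltr1n.
rewrite /ins_bound div1r; congr (_^-1); rewrite mulrDr; congr (_ + _).
  rewrite (_ : 1 - Hb p = capacity p / ln 2); first by rewrite div1r invf_div.
  by rewrite /Hb /capacity /log2 /xlnx; field; rewrite gt_eqF.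
rewrite /invD /inv_kl_flip; case: eqP => [_|_]; first by rewrite mulr0.
rewrite (_ : Dpq p = kl_flip p / ln 2); first by rewrite div1r invf_div.
by rewrite /Dpq /kl_flip /log2; ring.
Qed.

(** A positive rate excludes an infinite supremum, which [rate] sends to 0. *)
Lemma rate_ge_maxEM (p Rins : R) n (c : Defs.code R) : 0 < Rins ->
  (Rins%:E <= rate p n c)%E ->
  exists2 r, maxEM p n c = r%:E & r <= n%:R * log2 n%:R / Rins.
Proof.
move=> R0; rewrite /rate; case: (maxEM p n c) => [r| |]; last 2 first.
- by rewrite lee_fin leNgt R0.
- by rewrite lee_fin leNgt R0.
have X0 : 0 <= n%:R * log2 n%:R :> R.
  rewrite mulr_ge0//; case: n => [|n]; first by rewrite /log2 ln0// mul0r.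
  by rewrite /log2 divr_ge0// ln_ge0// ler1n.
move=> h; exists r => //; move: h; case: eqP => [->|/eqP rn0]; first by rewrite divr_ge0// ltW.
rewrite lee_fin; have [r0|r0] := ltP 0 r.
  by rewrite ler_pdivlMr// mulrC -ler_pdivlMr// mulrC.
by move=> _; apply: le_trans r0 _; rewrite divr_ge0// ltW.
Qed.

(** The same e serves as phase threshold and as error probability. The claim is
    [expected_queries_ge] divided by n ln n, with lower-order terms vanishing for large n. *)
Lemma rate_tradeoff (p Rins e : R) : 0 <= p -> p < 1 / 2 -> 0 < Rins ->
  ins_achievable p Rins -> 0 < e -> e <= 1 / 2 ->
  (1 - e) / capacity p + inv_kl_flip p <=
  (ln 2 * Rins)^-1 + ((capacity p)^-1 + inv_kl_flip p) * e.
Proof.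
move=> p0 p2 R0 [c [cv [[N1 hrate] herr]]] e0 e2.
have C0 := capacity_gt0 p0 p2; have Ci : 0 < (capacity p)^-1 by rewrite invr_gt0.
have l2 : 0 < ln 2 :> R by rewrite ln_gt0// ltr1n.
have k0 := inv_kl_flip_ge0 p0 p2.
have p01 : 0 <= p <= 1 by apply/andP; split; lra.
(* From here on C denotes the reciprocal of the capacity. *)
set k := inv_kl_flip p in k0 *; set C := (capacity p)^-1 in Ci *.
set rho := (ln 2 * Rins)^-1.
have [K K0 [N2 hsearch]] := search_cost_lower_bound p0 p2 e0 e2.
have [N3 {}herr] := herr e e0.
pose lhs := (1 - e) * C + k; pose rhs := rho + (C + k) * e.
rewrite leNgt; apply/negP; rewrite -/lhs -/rhs => gap.
have g0 : 0 < lhs - rhs by rewrite subr_gt0.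
(* Coefficients of the terms linear in n: C from Stirling, k from having n - 1 searches and ln n <=
   n, K from the search bound, e from the part n of Lam. *)
pose M := C + k + K + e.
have M0 : 0 <= M by rewrite /M; lra.
have [n [nN1 nN2 nN3 nN4]] :
    exists n, [/\ N1 <= n, N2 <= n, N3 <= n & Num.truncn (expR (M / (lhs - rhs))) < n]%N.
  exists (maxn (maxn N1 N2) (maxn N3 (Num.truncn (expR (M / (lhs - rhs)))).+1)).
  by split; rewrite !leq_max ?leqnn ?orbT.
have n0 : (0 < n)%N by apply: leq_ltn_trans nN4.
have nR : 0 < n%:R :> R by rewrite ltr0n.
have L0 : 0 <= ln n%:R :> R by rewrite ln_ge0// ler1n.
have Lbig : M < (lhs - rhs) * ln n%:R.
  rewrite mulrC -ltr_pdivrMr// -[ltLHS]expRK ltr_ln ?posrE ?expR_gt0//.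
  apply: lt_le_trans (truncnS_gt _) _; by rewrite ler_nat.
have Lle : ln n%:R <= n%:R :> R by apply/ltW/ln_sublinear.
set L := ln n%:R in L0 Lbig Lle.
have [r maxr rle] := rate_ge_maxEM R0 (hrate n nN1).
pose phi t := (1 - e) * ln t.+1%:R / capacity p + k * L - K.
have phile i : (i < n)%N -> phi i <= L * (C + k).
  move=> lin; have : ln i.+1%:R <= L by rewrite ler_ln ?posrE ?ltr0n// ler_nat.
  move=> /(ler_wpM2r (ltW Ci)).
  have : 0 <= e * (ln i.+1%:R * C).
    by rewrite mulr_ge0 ?(ltW e0)// mulr_ge0 ?(ltW Ci)// ln_ge0// ler1n.
  rewrite /phi -/C; lra.
pose Lam := n%:R + n%:R * (L * (C + k)).
(* Lam is the search penalty n plus a uniform bound on n searches, hence of order n ln n. *)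
have LCk : 0 <= L * (C + k) by rewrite mulr_ge0// addr_ge0// ltW.
have Lam_ge t : n%:R + \sum_(t <= i < n) phi i <= Lam.
  rewrite lerD2l; apply: (@le_trans _ _ (\sum_(t <= i < n) L * (C + k))).
    by apply: ler_sum_nat => i /andP[_]; apply: phile.
  by rewrite big_const_nat iter_addr_0 -[_ *+ (n - t)]mulr_natl ler_wpM2r// ler_nat leq_subr.
have search_ge t (x : 'I_t.+1 -> query t -> bool) N : (0 < t < n)%N ->
    t.+1%:R * phi t <= \sum_l search_cost p (@c n t) n%:R (x l) N [::] l.
  by move=> /andP[t0 tn]; apply: hsearch => //; apply: cv.
have Lam0 : 0 <= Lam by rewrite addr_ge0// mulr_ge0.
have EMr theta : distinct_on n theta -> (Defs.EM p n (c n) theta <= r%:E)%E.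
  by move=> dt; rewrite -maxr; apply: ereal_sup_ubound; exists theta.
have := expected_queries_ge (cv n) p01 search_ge Lam_ge n0 Lam0 EMr (herr n nN3).
have sumphi : (1 - e) * C * (n%:R * L - n%:R) + (n%:R - 1) * (k * L - K) <= \sum_(1 <= i < n) phi i.
  have -> : \sum_(1 <= i < n) phi i =
      (1 - e) * C * \sum_(1 <= i < n) ln i.+1%:R + (n%:R - 1) * (k * L - K).
    have <- : \sum_(1 <= i < n) (k * L - K) = (n%:R - 1) * (k * L - K).
      by rewrite big_const_nat iter_addr_0 -[_ *+ (n - 1)]mulr_natl natrB.
    rewrite mulr_sumr -big_split.
    by apply: eq_bigr => i _; rewrite /phi -/C /=; ring.
  rewrite lerD2r ler_wpM2l ?sum_ln_ge//.
  by rewrite mulr_ge0 ?(ltW Ci)//; lra.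
have rle' : r <= n%:R * (L * rho).
  apply: le_trans rle _; rewrite /log2 /rho -/L invfM !mulrA; lra.
have : M * n%:R < (lhs - rhs) * L * n%:R by rewrite ltr_pM2r.
have b1 : 0 <= k * (n%:R - L) by rewrite mulr_ge0// subr_ge0.
have b2 : 0 <= e * C * n%:R by rewrite mulr_ge0// mulr_ge0// ltW.
move: sumphi rle' b1 b2 K0; rewrite /lhs /rhs /M /Lam -/C.
move: (\sum_(1 <= i < n) phi i) => S; nra.
Qed.

End Asymptotics.

(** * The capacity bound, by letting the error tolerance tend to zero *)

Theorem theorem4 (R : realType) (p : R) :
  0 <= p -> p < 1 / 2 -> (C_ins p <= (ins_bound p)%:E)%E.
Proof.
move=> p0 p2; have C0 := capacity_gt0 p0 p2.
have Ci : 0 < (capacity p)^-1 by rewrite invr_gt0.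
have l2 : 0 < ln 2 :> R by rewrite ln_gt0// ltr1n.
have k0 := inv_kl_flip_ge0 p0 p2.
apply: ge_ereal_sup => _ [Rins ach <-]; rewrite lee_fin ins_boundE//.
set B := (capacity p)^-1 + inv_kl_flip p.
have B0 : 0 < B by rewrite ltr_wpDr.
have [R0|] := ltP 0 Rins; last by move=> h; apply: le_trans h _; rewrite invr_ge0 mulr_ge0// ltW.
have lR : 0 < ln 2 * Rins by rewrite mulr_gt0.
have goal : B <= (ln 2 * Rins)^-1.
  rewrite leNgt; apply/negP => gap; set G := B - (ln 2 * Rins)^-1.
  have G0 : 0 < G by rewrite subr_gt0.
  pose S := (capacity p)^-1 + B.
  have S0 : 0 < S by rewrite addr_gt0.
  (* The tradeoff amounts to G <= e S, while this e satisfies e <= 1/2 and e S < G. *)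
  pose e := G / (2 * (G + S)).
  have GS : 0 < 2 * (G + S) by lra.
  have e0 : 0 < e by rewrite divr_gt0.
  have e2 : e <= 1 / 2 by rewrite ler_pdivrMr//; lra.
  have := rate_tradeoff p0 p2 R0 ach e0 e2; rewrite -/B => h.
  have eG : e * (2 * (G + S)) = G by rewrite mulfVK ?gt_eqF.
  have eG0 : 0 < e * G by rewrite mulr_gt0.
  have : e * S < G by lra.
  rewrite /S /G; move: h; rewrite /B; lra.
move: goal; rewrite -[leRHS]div1r ler_pdivlMr// => h.
by rewrite -[leRHS]div1r ler_pdivlMr ?mulr_gt0//; lra.
Qed.
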